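(* Every minion $\mathcal M$ such that all sets $\mathcal M^{(n)}$ ($n\in\mathbb N$) are finite has a minion core, i.e., a minion core $\mathcal N$ with $\mathcal M\sim\mathcal N$, and this minion core is unique up to minion isomorphism.
   Context: A minion $\mathcal M$ is a family of nonempty sets $\mathcal M^{(n)}$ ($n\in\mathbb N$) together with maps $\mathcal M^{(\alpha)}:\mathcal M^{(n)}\to\mathcal M^{(m)}$ for every function $\alpha:[n]\to[m]$, such that $\mathcal M^{(\mathrm{id}_{[n]})}=\mathrm{id}$ and $\mathcal M^{(\alpha)}\circ\mathcal M^{(\beta)}=\mathcal M^{(\alpha\circ\beta)}$ whenever defined. A (minion) homomorphism $\xi:\mathcal M\to\mathcal N$ is a family of maps $\xi^{(n)}:\mathcal M^{(n)}\to\mathcal N^{(n)}$ with $\xi^{(m)}(\mathcal M^{(\alpha)}(f))=\mathcal N^{(\alpha)}(\xi^{(n)}(f))$ for all $f\in\mathcal M^{(n)}$, $\alpha:[n]\to[m]$. An isomorphism is an invertible homomorphism; an automorphism is an isomorphism of a minion to itself. $\mathcal M\sim\mathcal N$ means there are homomorphisms $\mathcal M\to\mathcal N$ and $\mathcal N\to\mathcal M$. A minion is a minion core if every homomorphism from it to itself is an automorphism. *)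

(* Defs.v *)
From mathcomp Require Import all_boot.
From mathcomp Require Import classical_sets cardinality.

Set Implicit Arguments.
Unset Strict Implicit.
Unset Printing Implicit Defensive.

Local Open Scope classical_set_scope.

(* Arities are the positive integers, and [M n] stands for M^(n+1): if arity 0
   were allowed, the images of an element of M^(0) would form a one-element
   subminion, so all minions would be homomorphically equivalent.
   [minor α] is M^(α). *)
Record minion := Minion {
  carrier :> nat -> Type;
  carrier_inhabited : forall n, [set: carrier n] !=set0;
  minor : forall n m, ('I_n.+1 -> 'I_m.+1) -> carrier n -> carrier m;
  minor_id : forall n (f : carrier n), minor id f = f;
  minor_comp : forall n m k (α : 'I_m.+1 -> 'I_k.+1) (β : 'I_n.+1 -> 'I_m.+1)
    (f : carrier n), minor α (minor β f) = minor (α \o β) f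
}.

Record minion_hom (M N : minion) := MinionHom {
  hom_fun :> forall n, M n -> N n;
  hom_minor : forall n m (α : 'I_n.+1 -> 'I_m.+1) (f : M n),
    hom_fun (minor α f) = minor α (hom_fun f)
}.

Definition is_iso (M N : minion) (ξ : minion_hom M N) : Prop :=
  exists ζ : minion_hom N M,
    (forall n, cancel (@ξ n) (@ζ n)) /\ (forall n, cancel (@ζ n) (@ξ n)).

Definition isomorphic (M N : minion) : Prop :=
  exists ξ : minion_hom M N, is_iso ξ.

Definition hom_equiv (M N : minion) : Prop :=
  inhabited (minion_hom M N) /\ inhabited (minion_hom N M).

Definition is_minion_core (M : minion) : Prop :=
  forall ξ : minion_hom M M, is_iso ξ.

Definition minion_core_of (N M : minion) : Prop :=
  is_minion_core N /\ hom_equiv M N.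

(* Main.v *)
(* Uniqueness: homomorphisms between two equivalent cores compose to
   automorphisms on both sides, hence are isomorphisms. Existence: an
   ultrafilter limit of endomorphisms of a minion with finite levels is again
   an endomorphism, so by Zorn's lemma some endomorphism has a minimal image.
   By minimality every endomorphism of that image is surjective, hence
   bijective because the levels are finite. *)

Require Import Defs.
From mathcomp Require Import all_boot.
From mathcomp Require Import classical_sets cardinality.
From mathcomp Require Import boolp filter.

Set Implicit Arguments.
Unset Strict Implicit.
Unset Printing Implicit Defensive.

Local Open Scope classical_set_scope.

(** Counting: [g] is injective, so on a finite type it is onto, and its left inverse is
    two-sided. *)
Lemma finite_cancel_sym (T : Type) (f g : T -> T) :
  finite_set [set: T] -> cancel g f -> cancel f g.
Proof.
elim/Pchoice: T => T in f g *.
move=> /finite_seqP[s0 Es0] gK; pose s := undup s0.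
have s_all x : x \in s by rewrite mem_undup; have : [set: T] x by []; rewrite Es0.
have us : uniq (map g s) by rewrite map_inj_uniq ?undup_uniq//; exact: can_inj gK.
have [//|_ Egs] := uniq_min_size us (fun x _ => s_all x); first by rewrite size_map.
move=> x; have : x \in map g s by rewrite Egs.
by case/mapP => y _ ->; rewrite gK.
Qed.

(** The fibres of [f] form a finite partition of [E], and an ultrafilter contains one block of it.
    The induction discards candidate values one at a time. *)
Lemma ultra_finite_cst (E T : Type) (U : set_system E) (f : E -> T) :
  UltraFilter U -> finite_set [set: T] -> exists y, U [set e | f e = y].
Proof.
elim/Pchoice: T => T in f *.
move=> UU /finite_seqP[s Es].
have : U [set e | f e \in s].
  by apply: filterS filterT => e _ /=; have : [set: T] (f e) by []; rewrite Es.
elim: s {Es} => [|y s IHs] Us.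
  by have [e] := filter_ex Us.
have [Uy|UNy] := in_ultra_setVsetC [set e | f e = y] UU; first by exists y.
apply: IHs; apply: filterS (filterI Us UNy) => e [] /=.
by rewrite inE => /orP[/eqP|].
Qed.

Definition hom_id (M : minion) : minion_hom M M :=
  @MinionHom M M (fun n => id) (fun n m α f => erefl).

Lemma hom_comp_minor (L M N : minion) (ξ : minion_hom M N) (ζ : minion_hom L M)
    n m (α : 'I_n.+1 -> 'I_m.+1) (f : L n) :
  ξ m (ζ m (minor α f)) = minor α (ξ n (ζ n f)).
Proof. by rewrite !hom_minor. Qed.

Definition hom_comp (L M N : minion) (ξ : minion_hom M N) (ζ : minion_hom L M) :
  minion_hom L N := MinionHom (hom_comp_minor ξ ζ).

(** A levelwise inverse of a homomorphism commutes with minors automatically. *)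
Lemma cancel_is_iso (M N : minion) (ξ : minion_hom M N)
    (g : forall n, N n -> M n) :
  (forall n, cancel (@ξ n) (@g n)) -> (forall n, cancel (@g n) (@ξ n)) ->
  is_iso ξ.
Proof.
move=> ξK gK.
have g_minor n m (α : 'I_n.+1 -> 'I_m.+1) (f : N n) :
    g m (minor α f) = minor α (g n f).
  by rewrite -{1}(gK n f) -hom_minor ξK.
by exists (MinionHom g_minor).
Qed.

Lemma minion_core_iso (N N' : minion) :
  is_minion_core N -> is_minion_core N' -> hom_equiv N N' -> isomorphic N N'.
Proof.
move=> coreN coreN' [[f] [g]]; exists f.
have [h [gfK _]] := coreN (hom_comp g f).
have [k [_ fgK]] := coreN' (hom_comp f g).
have hgK n : cancel (@f n) (fun y => h n (g n y)) by exact: gfK.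
apply: (@cancel_is_iso _ _ f (fun n y => h n (g n y))) => // n y.
(* [f] is onto, since [y] is [f] applied to [g (k y)]; hence the left inverse [h \o g] of [f] is
   also a right inverse. *)
by rewrite -(fgK n y) /= hgK.
Qed.

Lemma hom_equiv_sym (M N : minion) : hom_equiv M N -> hom_equiv N M.
Proof. by case. Qed.

Lemma hom_equiv_trans (L M N : minion) :
  hom_equiv L M -> hom_equiv M N -> hom_equiv L N.
Proof.
move=> [[lm] [ml]] [[mn] [nm]].
by split; [exact: (inhabits (hom_comp mn lm)) | exact: (inhabits (hom_comp ml nm))].
Qed.

Section Image.
Variables (M N : minion) (ξ : minion_hom M N).

Definition image_carrier (n : nat) : Type := set_type (range (@ξ n)).

Definition to_image (n : nat) (f : M n) : image_carrier n :=
  exist _ (ξ n f) (mem_set (imageT (@ξ n) f)).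

Lemma image_carrier_inhabited n : [set: image_carrier n] !=set0.
Proof. by have [f _] := carrier_inhabited M n; exists (to_image f). Qed.

Lemma minor_in_image n m (α : 'I_n.+1 -> 'I_m.+1) (x : image_carrier n) :
  minor α (val x) \in range (@ξ m).
Proof.
by have [f _ <-] := set_valP x; rewrite -hom_minor; exact/mem_set/imageT.
Qed.

Definition image_minor n m (α : 'I_n.+1 -> 'I_m.+1) (x : image_carrier n) :
  image_carrier m := exist _ (minor α (val x)) (minor_in_image α x).

Lemma image_minor_id n (x : image_carrier n) : image_minor id x = x.
Proof. by apply: val_inj; exact: minor_id. Qed.

Lemma image_minor_comp n m k (α : 'I_m.+1 -> 'I_k.+1) (β : 'I_n.+1 -> 'I_m.+1)
    (x : image_carrier n) :
  image_minor α (image_minor β x) = image_minor (α \o β) x.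
Proof. by apply: val_inj; exact: minor_comp. Qed.

Definition image_minion : minion :=
  Minion image_carrier_inhabited image_minor_id image_minor_comp.

Definition image_incl : minion_hom image_minion N :=
  @MinionHom image_minion N (fun n => val) (fun n m α x => erefl).

Lemma to_image_minor n m (α : 'I_n.+1 -> 'I_m.+1) (f : M n) :
  to_image (minor α f) = image_minor α (to_image f).
Proof. by apply: val_inj; exact: hom_minor. Qed.

Definition image_proj : minion_hom M image_minion :=
  @MinionHom M image_minion to_image to_image_minor.

End Image.

(** The limit is taken pointwise. Each compatibility equation involves only two of its values, so
    some single homomorphism agrees with the limit at both. *)
Lemma ultra_hom_limit (M N : minion) (U : set_system (minion_hom M N)) :
  UltraFilter U -> (forall n, finite_set [set: N n]) ->
  exists ξ : minion_hom M N,
    forall n (x : M n), U [set e : minion_hom M N | e n x = ξ n x].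
Proof.
move=> UU Nfin.
have lim n (x : M n) : {y | U [set e : minion_hom M N | e n x = y]}.
  by apply: cid; exact: ultra_finite_cst.
have lim_minor n m (α : 'I_n.+1 -> 'I_m.+1) (x : M n) :
    sval (lim m (minor α x)) = minor α (sval (lim n x)).
  have [e [/= <- <-]] :=
    filter_ex (filterI (svalP (lim m (minor α x))) (svalP (lim n x))).
  exact: hom_minor.
by exists (MinionHom lim_minor) => n x; exact: (svalP (lim n x)).
Qed.

Lemma exists_minimal_image (M : minion) :
  (forall n, finite_set [set: M n]) ->
  exists e : minion_hom M M, forall e' : minion_hom M M,
    (forall n, range (@e' n) `<=` range (@e n)) ->
    forall n, range (@e n) `<=` range (@e' n).
Proof.
move=> Mfin.
(* Zorn's lemma is applied to the sets that avoid the image of some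
   endomorphism. *)
pose avoids (A : set {n & M n}) (e : minion_hom M M) :=
  forall n x, ~ A (existT _ n (e n x)).
have [F Fex Ftot|A [[e eA] maxA]] :=
    @Zorn_bigcup {n & M n} [set A | exists e, avoids A e].
  have [->|/set0P[A0 FA0]] := eqVneq F set0.
    by exists (hom_id M) => n x; rewrite bigcup_set0.
  (* Larger members of the chain are avoided by fewer endomorphisms, so these nonempty sets of
     endomorphisms form a filter base. *)
  have PG : ProperFilter (filter_from F avoids).
    apply: filter_from_proper => [|A /Fex //].
    apply: filter_from_filter; first by exists A0.
    move=> A B FA FB; have [AB|BA] := Ftot A B FA FB.
      by exists B => // e eB; split=> // n x /AB; exact: eB.
    by exists A => // e eA; split=> // n x /BA; exact: eA.
  have [U [UU GU]] := ultraFilterLemma PG.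
  have [ξ Uξ] := ultra_hom_limit UU Mfin.
  (* At each point the limit agrees with some endomorphism avoiding [A]. *)
  exists ξ => n x [A FA]; have UA : U (avoids A) by apply: GU; exists A.
  have [e [eA /= <-]] := filter_ex (filterI UA (Uξ n x)).
  exact: eA.
exists e => e' e'e n _ [x _ <-].
have [//|nx] := pselect (range (@e' n) (e n x)).
(* The complement of the image of [e'] contains [A], and properly so if it contains [e n x], against
   maximality. *)
pose B := [set p : {n & M n} | ~ range (@e' (projT1 p)) (projT2 p)].
have [] := maxA B; last by exists e' => k y; apply; exact: imageT.
split; last by move=> /(_ (existT _ n (e n x)) nx); exact: eA.
move=> [k y] Ay [z _ /= ez].
have [|w _ ew] := e'e k y; first by exists z.
by apply: (eA k w); rewrite ew.
Qed.

Lemma minimal_image_core (M : minion) (e : minion_hom M M) :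
  (forall n, finite_set [set: M n]) ->
  (forall e' : minion_hom M M,
    (forall n, range (@e' n) `<=` range (@e n)) ->
    forall n, range (@e n) `<=` range (@e' n)) ->
  is_minion_core (image_minion e).
Proof.
move=> Mfin emin ξ.
have surj n (y : image_minion e n) : {x | ξ n x = y}.
  apply: cid.
  (* Carrying [ξ] back to an endomorphism of [M] brings minimality to bear: the image of [e'] lies
     in that of [e], so it is all of it, and [ξ] is onto. *)
  pose e' := hom_comp (image_incl e) (hom_comp ξ (image_proj e)).
  have [k _ [x _ <-]|x _ e'x] := emin e' _ n (val y) (set_valP y).
    exact: (set_valP (ξ k (to_image e x))).
  by exists (to_image e x); apply: val_inj.
have gK n : cancel (fun y => sval (surj n y)) (@ξ n) by move=> y; exact: (svalP (surj n y)).
apply: (cancel_is_iso _ gK) => n; apply: finite_cancel_sym (gK n).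
by rewrite (eq_finite_set (card_setT _)); exact: finite_image.
Qed.

Theorem theorem3p4 (M : minion)
    (M_finite : forall n : nat, finite_set [set: M n]%classic) :
  (exists N : minion, minion_core_of N M) /\
  (forall N N' : minion,
     minion_core_of N M -> minion_core_of N' M -> isomorphic N N').
Proof.
split.
  have [e emin] := exists_minimal_image M_finite.
  exists (image_minion e); split; first exact: minimal_image_core.
  by split; [exact: (inhabits (image_proj e)) | exact: (inhabits (image_incl e))].
move=> N N' [coreN MN] [coreN' MN']; apply: minion_core_iso => //.
exact: hom_equiv_trans (hom_equiv_sym MN) MN'.
Qed.
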